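(* Let $P$ be a family of quasi-pseudometrics on a set $X$ generating a quasi-uniformity $\mathcal U=\mathcal U_P$ such that $(X,\mathcal U)$ is sequentially right $K$-complete. Suppose that the proper function $f:X\to[0,\infty]$ satisfies the condition that, for every sequence $(x_n)$ in $X$ and every $x\in X$, if $(x_n)$ is $\tau(\mathcal U)$-convergent to $x$ and $f(x_n)\to 0$, then $f(x)=0$. Suppose also that there exist $\lambda>0$ and $0<\mu<1$ such that for every $x\in X$ there exists $x'\in X$ such that (i) $d(x',x)\le\lambda f(x)$ for all $d\in P$, and (ii) $f(x')\le\mu f(x)$. Then for every $x_0\in\operatorname{dom} f$ there exists $\bar x\in X$ such that (i) $f(\bar x)=0=\inf f(X)$; and (ii) $d(\bar x,x_0)\le\dfrac{\lambda}{1-\mu}\,f(x_0)$ for all $d\in P$.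
   Context: A quasi-pseudometric on $X$ is a function $d:X\times X\to\mathbb R_+=[0,\infty)$ with $d(x,x)=0$ and $d(x,z)\le d(x,y)+d(y,z)$ for all $x,y,z\in X$. A family $P$ of quasi-pseudometrics generates the quasi-uniformity $\mathcal U_P$ on $X$ having as subbasis the sets $V_{d,\varepsilon}=\{(x,y)\in X\times X:d(x,y)<\varepsilon\}$, $d\in P$, $\varepsilon>0$ (i.e. $\mathcal U_P$ consists of all supersets of finite intersections of such sets). The topology $\tau(\mathcal U)$ has $\{U(x):U\in\mathcal U\}$, $U(x)=\{y\in X:(x,y)\in U\}$, as neighborhood basis at $x$. A sequence $(x_n)$ is right $K$-Cauchy if for every $U\in\mathcal U$ there is $n_U\in\mathbb N$ such that $(x_{n+k},x_n)\in U$ for all $n\ge n_U$ and all $k\in\mathbb N$. $(X,\mathcal U)$ is sequentially right $K$-complete if every right $K$-Cauchy sequence is $\tau(\mathcal U)$-convergent to some point of $X$. $\operatorname{dom} f=\{x\in X:f(x)<\infty\}$; $f$ is proper if $\operatorname{dom} f\ne\emptyset$. *)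

(* Defs.v *)
From HB Require Import structures.
From mathcomp Require Import all_boot all_order all_algebra finmap.
From mathcomp Require Import all_classical all_reals all_analysis.

Set Implicit Arguments.
Unset Strict Implicit.
Unset Printing Implicit Defensive.

Import Order.TTheory GRing.Theory Num.Theory.
Import numFieldNormedType.Exports.

Local Open Scope classical_set_scope.
Local Open Scope ring_scope.

Record quasi_pseudometric (R : realType) (X : Type) := QuasiPseudometric {
  qpm :> X -> X -> R ;
  qpm_ge0 : forall x y, 0 <= qpm x y ;
  qpm_refl : forall x, qpm x x = 0 ;
  qpm_triangle : forall x y z, qpm x z <= qpm x y + qpm y z
}.

HB.instance Definition _ (R : realType) (X : Type) :=
  gen_eqMixin (quasi_pseudometric R X).
HB.instance Definition _ (R : realType) (X : Type) :=
  gen_choiceMixin (quasi_pseudometric R X).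

(* The library's uniformType also requires closure under inverse relations. *)
Record quasi_uniformity (X : Type) := QuasiUniformity {
  qu_entourage : set_system (X * X) ;
  qu_filter : Filter qu_entourage ;
  qu_refl : forall U x, qu_entourage U -> U (x, x) ;
  qu_split : forall U, qu_entourage U -> exists2 V, qu_entourage V &
    forall x y z, V (x, y) -> V (y, z) -> U (x, z)
}.

Definition qpm_set (R : realType) (X : Type)
    (de : quasi_pseudometric R X * R) : set (X * X) :=
  [set xy | de.1 xy.1 xy.2 < de.2].

(* The supersets of the finite intersections of the sets d(x, y) < e with
   d in P and e > 0; the empty intersection is setT. *)
Definition qpm_entourage (R : realType) (X : Type)
    (P : set (quasi_pseudometric R X)) : set_system (X * X) :=
  filter_from
    (finI_from (P `*` [set e : R | 0 < e]) (@qpm_set R X)) id.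

Section generated.
Context (R : realType) (X : Type) (P : set (quasi_pseudometric R X)).

Lemma qpm_entourage_filter : Filter (qpm_entourage P).
Proof.
apply: filter_from_filter; last first.
  by move=> A B FA FB; exists (A `&` B) => //; exact: finI_fromI.
by exists setT, fset0 => //; rewrite set_fset0 bigcap_set0.
Qed.

Lemma qpm_entourage_refl U x : qpm_entourage P U -> U (x, x).
Proof.
case=> _ [D' D'P <-]; apply=> -[d e] /= /D'P; rewrite inE /= => -[_ e0].
by rewrite /qpm_set /= qpm_refl.
Qed.

Lemma qpm_entourage_split U : qpm_entourage P U ->
  exists2 V, qpm_entourage P V & forall x y z, V (x, y) -> V (y, z) -> U (x, z).
Proof.
case=> _ [D' D'P <-] D'U.
pose h (de : quasi_pseudometric R X * R) := (de.1, de.2 / 2).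
pose D2 := [fset h de | de in D']%fset.
exists (\bigcap_(de in [set` D2]) qpm_set de).
  exists (\bigcap_(de in [set` D2]) qpm_set de) => //; exists D2 => //.
  move=> _ /imfsetP [de /= /D'P + ->]; rewrite !inE /= => -[Pd e0].
  by split => //=; rewrite divr_gt0.
move=> x y z xy yz; apply: D'U => de deD'.
have hD : h de \in D2 by apply/imfsetP; exists de.
rewrite /qpm_set /= (splitr de.2).
apply: le_lt_trans (qpm_triangle _ _ y _) _.
by apply: ltrD; [exact: (xy _ hD)|exact: (yz _ hD)].
Qed.

Definition generated_qu : quasi_uniformity X :=
  QuasiUniformity qpm_entourage_filter qpm_entourage_refl qpm_entourage_split.

End generated.

(* X endowed with the topology tau(U). *)
Definition qu_space (X : Type) (U : quasi_uniformity X) : Type := X.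

Section topology.
Context (X : Type) (U : quasi_uniformity X).

Definition qu_nbhs (x : qu_space U) : set_system (qu_space U) :=
  filter_from (qu_entourage U) (fun V => [set y | V (x, y)]).

Lemma qu_nbhs_filter x : ProperFilter (qu_nbhs x).
Proof.
have FU := qu_filter U.
apply: filter_from_proper.
  apply: filter_from_filter; first by exists setT; exact: filterT.
  by move=> V W UV UW; exists (V `&` W) => //; exact: filterI.
by move=> V UV; exists x; exact: qu_refl UV.
Qed.

Lemma qu_nbhs_singleton x A : qu_nbhs x A -> A x.
Proof. by case=> V UV; apply; exact: qu_refl UV. Qed.

Lemma qu_nbhs_nbhs x A : qu_nbhs x A -> qu_nbhs x (qu_nbhs^~ A).
Proof.
case=> V UV VA; have [W UW WV] := qu_split UV.
by exists W => // y Wxy; exists W => // z Wyz; exact/VA/(WV _ y).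
Qed.

HB.instance Definition _ := gen_eqMixin (qu_space U).
HB.instance Definition _ := gen_choiceMixin (qu_space U).
HB.instance Definition _ := hasNbhs.Build (qu_space U) qu_nbhs.
HB.instance Definition _ := Nbhs_isNbhsTopological.Build (qu_space U)
  qu_nbhs_filter qu_nbhs_singleton qu_nbhs_nbhs.

End topology.

(* Convergence in qu_space U, that is for the topology tau(U). *)
Definition qu_cvg (X : Type) (U : quasi_uniformity X) (u : nat -> X) (x : X) :=
  (u : nat -> qu_space U) @ \oo --> (x : qu_space U).

Definition right_K_cauchy (X : Type) (U : quasi_uniformity X) (u : nat -> X) :=
  forall V, qu_entourage U V -> exists n_V : nat,
    forall n k : nat, (n_V <= n)%N -> V (u (n + k)%N, u n).

Definition seq_right_K_complete (X : Type) (U : quasi_uniformity X) :=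
  forall u : nat -> X, right_K_cauchy U u -> exists x, qu_cvg U u x.

Definition edom (R : realType) (X : Type) (f : X -> \bar R) : set X :=
  [set x | (f x < +oo)%E].

Definition proper_fun (R : realType) (X : Type) (f : X -> \bar R) :=
  edom f !=set0.

(* Main.v *)
Require Import Defs.
From HB Require Import structures.
From mathcomp Require Import all_boot all_order all_algebra finmap.
From mathcomp Require Import all_classical all_reals all_analysis.

Set Implicit Arguments.
Unset Strict Implicit.
Unset Printing Implicit Defensive.

Import Order.TTheory GRing.Theory Num.Theory.
Import numFieldNormedType.Exports.

Local Open Scope classical_set_scope.
Local Open Scope ring_scope.

(** Iterating the descent map from [x0] gives a sequence [u] along which the
values [a n] of [f] decrease geometrically.  With [C = lambda / (1 - mu)], the
two descent inequalities combine into a Caristi-type inequality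
[[
  d (u n.+1) (u n) <= lambda * a n = C * (a n - mu * a n)
                   <= C * (a n - a n.+1),
]]
whose right-hand side telescopes: [d (u (n + k)) (u n) <= C * (a n - a (n + k))]
([descent_telescope]).  As [a >= 0], this is at most [C * a n], a bound free of
[d] and [k] that tends to [0] ([geometric_decay_cvg0]); so the sequence is right
K-Cauchy ([right_K_cauchy_generated]) and converges by
completeness to some [xbar].  The closedness hypothesis gives [f xbar = 0].

For the distance estimate, convergence to [xbar] in the topology of the
quasi-uniformity makes [d xbar (u n)] small ([qu_cvg_generated]), with [xbar] as
first argument, as the triangle inequality [d xbar x0 <= d xbar (u n) + d (u n) x0]
requires; the last term is at most [C * a 0], and [a 0] is [f x0]. *)

(** A right K-Cauchy condition says that a set of indices is eventual, and
eventual sets are stable under finite intersections; hence the subbasic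
entourages suffice. *)
Lemma right_K_cauchy_generated (R : realType) (X : Type)
    (P : set (quasi_pseudometric R X)) (u : nat -> X) :
  (forall (d : quasi_pseudometric R X) (e : R), P d -> 0 < e ->
    \forall n \near \oo, forall k, d (u (n + k)%N) (u n) < e) ->
  right_K_cauchy (generated_qu P) u.
Proof.
move=> u_cauchy V [_ [D DP <-] DV].
have [N _ NP] : \forall n \near \oo, (\bigcap_(de in [set` D])
    [set m | forall k, de.1 (u (m + k)%N) (u m) < de.2]) n.
  apply: filter_bigI => -[d e] /= /DP; rewrite inE => -[/= Pd e0].
  exact: u_cauchy.
by exists N => n k Nn; apply: DV => de deD; exact: (NP n Nn de deD k).
Qed.

Lemma qu_cvg_generated (R : realType) (X : Type)
    (P : set (quasi_pseudometric R X)) (u : nat -> X) (x : X)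
    (d : quasi_pseudometric R X) (e : R) :
  qu_cvg (generated_qu P) u x -> P d -> 0 < e ->
  \forall n \near \oo, d x (u n) < e.
Proof.
move=> ux Pd e0.
apply: (ux [set y | d x y < e]).
exists (qpm_set (d, e)) => //.
exists (qpm_set (d, e)) => //.
exists [fset (d, e)]%fset; first by move=> _ /fset1P ->; rewrite inE.
by rewrite set_fset1 bigcap_set1.
Qed.

Lemma descent_telescope (R : realType) (X : Type)
    (d : quasi_pseudometric R X) (u : nat -> X) (a : nat -> R) (C : R) :
  (forall n, d (u n.+1) (u n) <= C * (a n - a n.+1)) ->
  forall n k, d (u (n + k)%N) (u n) <= C * (a n - a (n + k)%N).
Proof.
move=> step n; elim=> [|k IHk]; first by rewrite addn0 qpm_refl subrr mulr0.
rewrite addnS; apply: le_trans (qpm_triangle d _ (u (n + k)%N) _) _.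
have -> : a n - a (n + k).+1 =
    (a (n + k)%N - a (n + k).+1) + (a n - a (n + k)%N).
  by rewrite [RHS]addrC subrKA.
by rewrite mulrDr lerD.
Qed.

Lemma geometric_decay_cvg0 (R : realType) (a : nat -> R) (mu : R) :
  0 <= mu -> mu < 1 -> (forall n, 0 <= a n) ->
  (forall n, a n.+1 <= mu * a n) -> a @ \oo --> (0 : R).
Proof.
move=> mu0 mu1 a0 aS.
have a_le n : a n <= geometric (a 0%N) mu n.
  elim: n => [|n IHn] /=; first by rewrite expr0 mulr1.
  by rewrite exprS mulrCA (le_trans (aS n))// ler_wpM2l.
apply: (@squeeze_cvgr _ _ _ _ (cst 0) (geometric (a 0%N) mu)).
- by apply: nearW => n; rewrite a0 a_le.
- exact: cvg_cst.
- by apply: cvg_geometric; rewrite ger0_norm.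
Qed.

Theorem corollary6p4 (R : realType) (X : Type)
    (P : set (quasi_pseudometric R X))
    (complete : seq_right_K_complete (generated_qu P))
    (f : X -> \bar R)
    (f_ge0 : forall x, (0 <= f x)%E)
    (f_proper : proper_fun f)
    (f_closed : forall (u : nat -> X) (x : X),
      qu_cvg (generated_qu P) u x -> f (u n) @[n --> \oo] --> 0%E -> f x = 0%E)
    (lambda mu : R) (lambda_gt0 : 0 < lambda) (mu_gt0 : 0 < mu) (mu_lt1 : mu < 1)
    (f_descent : forall x : X, exists x' : X,
      (forall d, P d -> ((d x' x)%:E <= lambda%:E * f x)%E) /\
      (f x' <= mu%:E * f x)%E) :
  forall x0 : X, edom f x0 -> exists xbar : X,
    (f xbar = 0%E /\ ereal_inf (range f) = 0%E) /\
    (forall d, P d -> ((d xbar x0)%:E <= (lambda / (1 - mu))%:E * f x0)%E).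
Proof.
move=> x0 fx0.
have [g g_descent] := choice f_descent.
pose u n := iter n g x0.
pose a n := fine (f (u n)).
have fu n : f (u n) = (a n)%:E.
  rewrite /a fineK// ge0_fin_numE//.
  elim: n => [//|n IHn]; apply: le_lt_trans (g_descent (u n)).2 _.
  have := IHn; rewrite -ge0_fin_numE// => /fineK <-.
  by rewrite -EFinM ltry.
have a_ge0 n : 0 <= a n by rewrite -lee_fin -fu.
have aS n : a n.+1 <= mu * a n.
  by rewrite -lee_fin EFinM -!fu; exact: (g_descent (u n)).2.
have a_cvg0 : a @ \oo --> (0 : R).
  exact: geometric_decay_cvg0 (ltW mu_gt0) mu_lt1 a_ge0 aS.
pose C := lambda / (1 - mu).
have C_gt0 : 0 < C by rewrite divr_gt0// subr_gt0.
have telescope d : P d ->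
    forall n k, d (u (n + k)%N) (u n) <= C * (a n - a (n + k)%N).
  move=> Pd; apply: descent_telescope => n.
  apply: (@le_trans _ _ (lambda * a n)).
    by rewrite -lee_fin EFinM -fu; exact: (g_descent (u n)).1.
  have -> : lambda * a n = C * (a n - mu * a n).
    by rewrite -{2}[a n]mul1r -mulrBl mulrA divfK// gt_eqF// subr_gt0.
  by rewrite ler_pM2l// lerB.
have u_bound d n k : P d -> d (u (n + k)%N) (u n) <= C * a n.
  move=> Pd; apply: le_trans (telescope d Pd n k) _.
  by rewrite ler_pM2l// gerBl.
have [xbar u_xbar] : exists x, qu_cvg (generated_qu P) u x.
  apply/complete/right_K_cauchy_generated => d e Pd e0.
  have : \forall n \near \oo, a n < e / C.
    by apply: (cvgr_lt _ a_cvg0); rewrite divr_gt0.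
  apply: filterS => n an k; apply: le_lt_trans (u_bound d n k Pd) _.
  by rewrite mulrC -ltr_pdivlMr.
have fxbar : f xbar = 0%E.
  apply: (f_closed u xbar u_xbar).
  by apply: cvg_EFin => //; apply: nearW => n; rewrite fu.
exists xbar; split; first split => //.
  apply/eqP; rewrite eq_le; apply/andP; split.
    by rewrite -fxbar; apply: ereal_inf_lbound; exists xbar.
  by apply: le_ereal_inf_tmp => _ [x _ <-].
move=> d Pd; rewrite (fu 0%N) -EFinM lee_fin -/C.
apply/ler_addgt0Pr => e e0.
have [N _ /(_ N (leqnn N)) dN] := qu_cvg_generated u_xbar Pd e0.
apply: le_trans (qpm_triangle d _ (u N) _) _.
by rewrite addrC lerD ?(ltW dN)//; exact: (u_bound d 0%N N Pd).
Qed.
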